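(* Let $\lambda$ be a nonzero complex number and $x$ a complex number. For every integer $n \geq 0$, $$C_{n,\lambda}(x) = \sum_{k=0}^n \sum_{m=0}^k \binom{n}{k}(x)_m\, C_{n-k,\lambda}\, \lambda^{k-m}\, S_1(k,m),$$ where $C_{n,\lambda}(x)$ are the degenerate Cauchy polynomials of the second kind, $C_{n,\lambda}=C_{n,\lambda}(0)$ are the degenerate Cauchy numbers of the second kind, $(x)_m$ is the falling factorial, and $S_1(k,m)$ are the (signed) Stirling numbers of the first kind.
   Context: All generating functions are formal power series in $t$; $\log(1+u)=\sum_{k\ge 1}\frac{(-1)^{k-1}}{k}u^k$ and $(1+u)^x=\sum_{k\ge 0}(x)_k\frac{u^k}{k!}$, where $(x)_0=1$ and $(x)_k=x(x-1)\cdots(x-k+1)$ for $k\geq 1$. The degenerate Cauchy polynomials of the second kind $C_{n,\lambda}(x)$ are defined by $$\frac{t}{\log\left(1+\frac{1}{\lambda}\log(1+\lambda t)\right)}\left(1+\tfrac{1}{\lambda}\log(1+\lambda t)\right)^x=\sum_{n=0}^\infty C_{n,\lambda}(x)\frac{t^n}{n!},$$ and $C_{n,\lambda}=C_{n,\lambda}(0)$ are the degenerate Cauchy numbers of the second kind. The Stirling numbers of the first kind $S_1(n,l)$ are defined by $(x)_n=\sum_{l=0}^n S_1(n,l)x^l$ for $n\ge 0$. *)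

(* Defs.v *)
From mathcomp Require Import all_boot all_algebra.

Set Implicit Arguments.
Unset Strict Implicit.
Unset Printing Implicit Defensive.

Import GRing.Theory.

Local Open Scope ring_scope.

Definition falling (A : nzRingType) (x : A) (k : nat) : A :=
  \prod_(i < k) (x - i%:R).

Definition stirling1 (n l : nat) : int := (falling ('X : {poly int}) n)`_l.

Section PowerSeries.

Variable K : fieldType.

(* [f : fps] stands for the formal power series $\sum_n f(n) t^n$. *)
Definition fps := nat -> K.

Implicit Types f g : fps.

Definition fps1 : fps := fun n => (n == 0)%N%:R.

Definition fpsX : fps := fun n => (n == 1)%N%:R.

Definition fps_scale (a : K) f : fps := fun n => a * f n.

Definition fps_mul f g : fps := fun n => \sum_(i < n.+1) f i * g (n - i)%N.

Definition fps_exp f (k : nat) : fps := iter k (fps_mul f) fps1.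

(* $\sum_k f(k) g^k$, meaningful only when [g 0 = 0]: then $g^k$ has no term
   of degree below $k$, so truncating the sum over $k$ at $n$ is harmless. *)
Definition fps_comp f g : fps :=
  fun n => \sum_(k < n.+1) f k * fps_exp g k n.

Fixpoint fps_inv_seq f (n : nat) : seq K :=
  if n is m.+1 then
    let s := fps_inv_seq f m in
    rcons s (- (f 0%N)^-1 * \sum_(i < m.+1) f i.+1 * s`_(m - i))
  else [:: (f 0%N)^-1].

(* The multiplicative inverse, meaningful only when [f 0 != 0]; see
   [fps_mul_inv]. *)
Definition fps_inv f : fps := fun n => (fps_inv_seq f n)`_n.

(* The quotient $t / g$, meaningful only when [g 0 = 0] and [g 1 != 0]: it is
   computed as $(g / t)^{-1}$; see [fps_Xdiv_mul]. *)
Definition fps_Xdiv g : fps := fps_inv (fun n => g n.+1).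

(* $\log(1 + t)$ *)
Definition fps_log1p : fps :=
  fun k => if k is j.+1 then (-1) ^+ j / j.+1%:R else 0.

(* $(1 + t)^x$ *)
Definition fps_pow1p (x : K) : fps := fun k => falling x k / k`!%:R.

(* $\frac{1}{\lambda}\log(1 + \lambda t)$ *)
Definition degenerate_log (lambda : K) : fps :=
  fps_scale lambda^-1 (fps_comp fps_log1p (fps_scale lambda fpsX)).

Definition log1p_degenerate_log (lambda : K) : fps :=
  fps_comp fps_log1p (degenerate_log lambda).

Definition cauchy2_series (lambda x : K) : fps :=
  fps_mul (fps_Xdiv (log1p_degenerate_log lambda))
          (fps_comp (fps_pow1p x) (degenerate_log lambda)).

Definition cauchy2_poly (n : nat) (lambda x : K) : K :=
  n`!%:R * cauchy2_series lambda x n.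

Definition cauchy2_number (n : nat) (lambda : K) : K := cauchy2_poly n lambda 0.

Lemma size_fps_inv_seq f n : size (fps_inv_seq f n) = n.+1.
Proof. by elim: n => //= n IHn; rewrite size_rcons IHn. Qed.

Lemma nth_fps_inv_seq f n i : (i <= n)%N -> (fps_inv_seq f n)`_i = fps_inv f i.
Proof.
elim: n => [|n IHn]; first by rewrite leqn0 => /eqP->.
rewrite leq_eqVlt => /predU1P[-> //|lt_in].
by rewrite /= nth_rcons size_fps_inv_seq lt_in IHn.
Qed.

Lemma fps_invS f n :
  fps_inv f n.+1 = - (f 0%N)^-1 * \sum_(i < n.+1) f i.+1 * fps_inv f (n - i)%N.
Proof.
rewrite {1}/fps_inv /= nth_rcons size_fps_inv_seq ltnn eqxx.
by congr (_ * _); apply: eq_bigr => i _; rewrite nth_fps_inv_seq ?leq_subr.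
Qed.

Lemma fps_mul_inv f : f 0%N != 0 -> fps_mul f (fps_inv f) =1 fps1.
Proof.
move=> f0 [|n]; rewrite /fps_mul /fps1 big_ord_recl /= subn0.
  by rewrite big_ord0 addr0 /fps_inv /= mulfV.
by rewrite fps_invS mulrA mulrN mulfV // mulN1r addNr.
Qed.

Lemma fps_Xdiv_mul g :
  g 0%N = 0 -> g 1%N != 0 -> fps_mul g (fps_Xdiv g) =1 fpsX.
Proof.
move=> g0 g1 [|n]; rewrite /fps_mul big_ord_recl g0 mul0r add0r.
  by rewrite big_ord0.
exact: (fps_mul_inv (f := fun n => g n.+1)).
Qed.

Lemma degenerate_log0 (lambda : K) : degenerate_log lambda 0%N = 0.
Proof.
by rewrite /degenerate_log /fps_scale /fps_comp big_ord1 mul0r mulr0.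
Qed.

Lemma log1p_degenerate_log0 (lambda : K) : log1p_degenerate_log lambda 0%N = 0.
Proof. by rewrite /log1p_degenerate_log /fps_comp big_ord1 mul0r. Qed.

Lemma fps_comp_log1p1 g : fps_comp fps_log1p g 1%N = g 1%N.
Proof.
rewrite /fps_comp !big_ord_recl big_ord0 /= mul0r add0r addr0.
rewrite expr0 divr1 mul1r /fps_exp /= /fps_mul !big_ord_recl big_ord0 /=.
by rewrite /fps1 /= mulr0 add0r mulr1 addr0.
Qed.

Lemma log1p_degenerate_log1 (lambda : K) :
  lambda != 0 -> log1p_degenerate_log lambda 1%N = 1.
Proof.
move=> l0; rewrite /log1p_degenerate_log fps_comp_log1p1 /degenerate_log /fps_scale fps_comp_log1p1.
by rewrite /fpsX mulr1 mulVf.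
Qed.

(* For [lambda != 0] the division in [cauchy2_series] is a genuine one. *)
Lemma log1p_degenerate_logK (lambda : K) : lambda != 0 ->
  fps_mul (log1p_degenerate_log lambda)
          (fps_Xdiv (log1p_degenerate_log lambda)) =1 fpsX.
Proof.
move=> l0; apply: fps_Xdiv_mul; first exact: log1p_degenerate_log0.
by rewrite log1p_degenerate_log1 ?oner_neq0.
Qed.

End PowerSeries.

(* Main.v *)
(* With g = log(1 + lambda t) / lambda, the series of C_{n,lambda}(x) is the
   series of C_{n,lambda} times (1 + g)^x = sum_m (x)_m g^m / m!, so it suffices
   to compute the coefficients of g^m.  Since (1 + lambda t) g' = 1, one has
   (1 + lambda t) (g^m)' = m g^(m-1), which on coefficients is the recurrence
   S_1(k+1, m) = S_1(k, m-1) - k S_1(k, m) up to normalisation, whence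
   [t^k] g^m = (m! / k!) lambda^(k-m) S_1(k, m). *)
Require Import Defs.
From mathcomp Require Import all_boot all_order all_algebra.
From mathcomp Require Import reals complex.
From mathcomp Require Import ring.

Set Implicit Arguments.
Unset Strict Implicit.
Unset Printing Implicit Defensive.

Import GRing.Theory Num.Theory.

Local Open Scope ring_scope.
Local Open Scope complex_scope.

(** * Falling factorials and the recurrence of the Stirling numbers *)

Lemma falling0r (A : nzRingType) (x : A) : falling x 0 = 1.
Proof. exact: big_ord0. Qed.

Lemma fallingS (A : nzRingType) (x : A) k :
  falling x k.+1 = falling x k * (x - k%:R).
Proof. exact: big_ord_recr. Qed.

Lemma falling0l (A : nzRingType) k : falling (0 : A) k = (k == 0)%N%:R.
Proof.
case: k => [|k]; first exact: falling0r.
by rewrite /falling big_ord_recl subrr mul0r.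
Qed.

Lemma stirling1_0 l : stirling1 0 l = (l == 0)%N%:R.
Proof. by rewrite /stirling1 falling0r coef1. Qed.

Lemma stirling1S0 k : stirling1 k.+1 0 = - (k%:R * stirling1 k 0).
Proof.
rewrite /stirling1 fallingS mulrBr coefB coefMX eqxx sub0r.
by rewrite mulr_natr coefMn mulr_natl.
Qed.

(** Compares coefficients of X^(l+1) in (X)_(k+1) = (X)_k (X - k). *)
Lemma stirling1SS k l :
  stirling1 k.+1 l.+1 = stirling1 k l - k%:R * stirling1 k l.+1.
Proof.
by rewrite /stirling1 fallingS mulrBr coefB coefMX mulr_natr coefMn mulr_natl.
Qed.

(** * The derivation (1 + c t) d/dt on power series, and substitutions *)

Section PowerSeries.

Variable K : fieldType.
Implicit Types (f g : fps K) (c : K).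

(* (1 + c t) f' *)
Definition fps_affine_deriv c f : fps K :=
  fun n => n.+1%:R * f n.+1 + c * (n%:R * f n).

Lemma fps_mul1l f : fps_mul (fps1 K) f =1 f.
Proof.
move=> n; rewrite /fps_mul big_ord_recl mul1r subn0.
by rewrite big1 ?addr0 // => i _; rewrite mul0r.
Qed.

Lemma fps_mulr1 f : fps_mul f (fps1 K) =1 f.
Proof.
move=> n; rewrite /fps_mul big_ord_recr subnn mulr1 big1 => [|i _]; first exact: add0r.
by rewrite /fps1 /= subn_eq0 leqNgt ltn_ord mulr0.
Qed.

Lemma eq_fps_mull f1 f2 g : f1 =1 f2 -> fps_mul f1 g =1 fps_mul f2 g.
Proof. by move=> eqf n; apply: eq_bigr => i _; rewrite eqf. Qed.

Lemma eq_fps_mulr f g1 g2 : g1 =1 g2 -> fps_mul f g1 =1 fps_mul f g2.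
Proof. by move=> eqg n; apply: eq_bigr => i _; rewrite eqg. Qed.

Lemma fps_mul_scaler c f g :
  fps_mul f (fps_scale c g) =1 fps_scale c (fps_mul f g).
Proof.
by move=> n; rewrite /fps_scale mulr_sumr; apply: eq_bigr => i _; rewrite mulrCA.
Qed.

(** Leibniz rule for t d/dt: the weight n is split as i + (n - i) in each term of the
    convolution. *)
Lemma fps_euler_mul f g n :
  n%:R * fps_mul f g n = \sum_(i < n.+1) i%:R * f i * g (n - i)%N
    + \sum_(i < n.+1) f i * ((n - i)%:R * g (n - i)%N).
Proof.
rewrite mulr_sumr -big_split /=; apply: eq_bigr => i _.
rewrite -{1}(subnKC (ltn_ord i : i <= n)%N) natrD; ring.
Qed.

Lemma fps_affine_deriv_mul c f g n :
  fps_affine_deriv c (fps_mul f g) n =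
  fps_mul (fps_affine_deriv c f) g n + fps_mul f (fps_affine_deriv c g) n.
Proof.
rewrite /fps_affine_deriv !fps_euler_mul.
(* Terms of weight zero are dropped, i = 0 in the first sum and i = n+1 in the second, so that all
   sums range over i < n+1. *)
rewrite big_ord_recl mul0r mul0r add0r.
rewrite [X in _ + X + _]big_ord_recr /= subnn mul0r mulr0 addr0.
rewrite mulrDr addrACA !mulr_sumr.
congr (_ + _); rewrite -big_split /=; apply: eq_bigr => i _.
  by rewrite /bump add1n subSS; ring.
by rewrite subSn -1?ltnS //; ring.
Qed.

(** Power rule, by induction from the Leibniz rule. *)
Lemma fps_affine_deriv_exp c f m :
  fps_affine_deriv c f =1 fps1 K ->
  fps_affine_deriv c (fps_exp f m.+1) =1 fps_scale m.+1%:R (fps_exp f m).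
Proof.
move=> f'1; elim: m => [|m IHm] n; rewrite fps_affine_deriv_mul.
  rewrite (eq_fps_mull _ f'1) fps_mul1l /fps_scale mul1r.
  (* This sum is f times the derivative of the constant 1. *)
  rewrite [X in _ + X]big1 ?addr0 // => i _.
  by rewrite /fps_affine_deriv /fps1; case: (n - i)%N => [|j] /=;
    rewrite ?mulr0 ?mul0r ?mulr0 ?addr0 ?mulr0.
rewrite (eq_fps_mull _ f'1) fps_mul1l (eq_fps_mulr _ IHm) fps_mul_scaler.
by rewrite /fps_scale (mulrS _ m.+1) mulrDl mul1r.
Qed.

Lemma fps_exp_scaleX c k n :
  fps_exp (fps_scale c (fpsX K)) k n = c ^+ k * (n == k)%:R.
Proof.
elim: k n => [|k IHk] n; first by rewrite mul1r.
rewrite /fps_exp iterS -/(fps_exp _ _) /fps_mul big_ord_recl.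
rewrite {1}/fps_scale /fpsX mulr0 mul0r add0r.
case: n => [|n]; first by rewrite big_ord0 mulr0.
rewrite big_ord_recl big1 => [|i _]; last by rewrite /fps_scale mulr0 mul0r.
by rewrite /= subSS subn0 IHk /fps_scale mulr1 addr0 eqSS exprS mulrA.
Qed.

Lemma fps_comp_scaleX f c n : fps_comp f (fps_scale c (fpsX K)) n = f n * c ^+ n.
Proof.
rewrite /fps_comp big_ord_recr /= fps_exp_scaleX eqxx mulr1 big1 ?add0r // => i _.
by rewrite fps_exp_scaleX gtn_eqF ?mulr0.
Qed.

Lemma fps_exp_coef0 f m : f 0%N = 0 -> fps_exp f m 0%N = (m == 0)%N%:R.
Proof.
by case: m => // m f0; rewrite /fps_exp iterS /fps_mul big_ord1 f0 mul0r.
Qed.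

Lemma fps_comp_pow1p0 g : fps_comp (fps_pow1p (0 : K)) g =1 fps1 K.
Proof.
move=> n; rewrite /fps_comp big_ord_recl big1 => [|i _].
  by rewrite /fps_pow1p falling0r fact0 divr1 mul1r addr0.
by rewrite /fps_pow1p falling0l !mul0r.
Qed.

(** At x = 0 the factor (1 + g)^x is 1, which leaves only the quotient t / log(1 + g). *)
Lemma cauchy2_numberE n (lambda : K) :
  cauchy2_number n lambda =
  n`!%:R * fps_Xdiv (log1p_degenerate_log lambda) n.
Proof.
rewrite /cauchy2_number /cauchy2_poly /cauchy2_series.
by rewrite (eq_fps_mulr _ (fps_comp_pow1p0 _)) fps_mulr1.
Qed.

End PowerSeries.

(** * Powers of the degenerate logarithm in characteristic zero *)

Section CharacteristicZero.

Variables (K : numFieldType) (lambda : K).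
Hypothesis lambda_neq0 : lambda != 0.

Lemma degenerate_log_affine_deriv :
  fps_affine_deriv lambda (degenerate_log lambda) =1 fps1 K.
Proof.
case=> [|n]; rewrite /fps_affine_deriv /degenerate_log /fps_scale.
  by rewrite !fps_comp_scaleX /fps1 /= mul0r mulr0 addr0; field.
have n1_neq0 : n.+1%:R != 0 :> K by rewrite pnatr_eq0.
have n2_neq0 : n.+2%:R != 0 :> K by rewrite pnatr_eq0.
rewrite !fps_comp_scaleX /fps1 /= !exprS.
(* The cancellation holds with arbitrary nonzero [a] and [b] in place of n+1 and n+2. *)
move: n.+1%:R n.+2%:R n1_neq0 n2_neq0 => a b a_neq0 b_neq0.
by field; rewrite lambda_neq0 a_neq0.
Qed.

(** Coefficient of t^k in (1 + lambda t) (g^(m+1))' = (m+1) g^m. *)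
Lemma degenerate_log_expS m k :
  k.+1%:R * fps_exp (degenerate_log lambda) m.+1 k.+1 =
  m.+1%:R * fps_exp (degenerate_log lambda) m k
    - lambda * (k%:R * fps_exp (degenerate_log lambda) m.+1 k).
Proof.
apply/eqP; rewrite -subr_eq opprK; apply/eqP.
exact: (fps_affine_deriv_exp m degenerate_log_affine_deriv k).
Qed.

(* Powers of [lambda] are put on both sides so that no truncated subtraction
   [k - m] appears when [k < m]. *)
Lemma degenerate_log_exp_mul m k :
  lambda ^+ m * (k`!%:R * fps_exp (degenerate_log lambda) m k) =
  m`!%:R * lambda ^+ k * (stirling1 k m)%:~R.
Proof.
elim: k m => [|k IHk] m.
  rewrite fps_exp_coef0 ?degenerate_log0 // stirling1_0.
  by case: m => [|m]; rewrite ?mulr0 // !mulr1.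
case: m => [|m].
  rewrite stirling1S0 rmorphN rmorphM /= [RHS]mulrN rmorph_nat.
  have := IHk 0%N; rewrite expr0 !mul1r => IHk0.
  rewrite exprS -[RHS]mulrN.
  have -> : lambda * lambda ^+ k * - (k%:R * (stirling1 k 0)%:~R) =
    - lambda * k%:R * (lambda ^+ k * (stirling1 k 0)%:~R) by ring.
  rewrite -IHk0 /fps_exp /= /fps1 /=.
  (* Both sides vanish: g^0 = 1 has no term in t^(k+1), and k times its coefficient of t^k is always
     zero. *)
  by case: (k) => [|j]; rewrite /= ?(mulr0, mul0r).
rewrite factS mulnC natrM -[k`!%:R * _ * _]mulrA degenerate_log_expS.
(* The recurrence is grouped so that the induction hypothesis applies at both m and m+1. *)
transitivity (lambda * m.+1%:R *
    (lambda ^+ m * (k`!%:R * fps_exp (degenerate_log lambda) m k))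
  - lambda * k%:R *
    (lambda ^+ m.+1 * (k`!%:R * fps_exp (degenerate_log lambda) m.+1 k))).
  by rewrite exprS; ring.
rewrite !IHk stirling1SS rmorphB rmorphM /= rmorph_nat factS natrM exprS.
ring.
Qed.

(** For m <= k, lambda^k = lambda^m lambda^(k-m), and lambda^m cancels. *)
Lemma degenerate_log_exp_coef m k : (m <= k)%N ->
  fps_exp (degenerate_log lambda) m k =
  m`!%:R / k`!%:R * lambda ^+ (k - m) * (stirling1 k m)%:~R.
Proof.
move=> le_mk; have fact_neq0 : k`!%:R != 0 :> K.
  by rewrite pnatr_eq0 -lt0n fact_gt0.
apply: (mulfI fact_neq0); apply: (mulfI (expf_neq0 m lambda_neq0)).
rewrite degenerate_log_exp_mul -{1}(subnKC le_mk) exprD.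
by field.
Qed.

(** The m! in the coefficient of g^m cancels the denominator of (x)_m / m!, and k! cancels
    likewise. *)
Lemma fps_comp_pow1p_degenerate_log (x : K) k :
  k`!%:R * fps_comp (fps_pow1p x) (degenerate_log lambda) k =
  \sum_(m < k.+1) falling x m * lambda ^+ (k - m) * (stirling1 k m)%:~R.
Proof.
rewrite mulr_sumr; apply: eq_bigr => m _.
have le_mk : (m <= k)%N by rewrite -ltnS.
rewrite (degenerate_log_exp_coef le_mk) /fps_pow1p.
have m_neq0 : m`!%:R != 0 :> K by rewrite pnatr_eq0 -lt0n fact_gt0.
have k_neq0 : k`!%:R != 0 :> K by rewrite pnatr_eq0 -lt0n fact_gt0.
by field; rewrite m_neq0 k_neq0.
Qed.

Lemma cauchy2_polyE (x : K) n :
  cauchy2_poly n lambda x =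
  \sum_(k < n.+1) \sum_(m < k.+1)
    'C(n, k)%:R * falling x m * cauchy2_number (n - k) lambda
      * lambda ^+ (k - m) * (stirling1 k m)%:~R.
Proof.
rewrite /cauchy2_poly /cauchy2_series /fps_mul mulr_sumr.
(* Reversing the convolution lets k index the factor (1 + g)^x and n - k the Cauchy number. *)
rewrite (reindex_inj rev_ord_inj); apply: eq_bigr => k _ /=.
have le_kn : (k <= n)%N by rewrite -ltnS.
(* Writing n! as 'C(n, k) k! (n - k)! gives each factor its own factorial. *)
rewrite subSS subKn // -(bin_fact le_kn) !natrM.
transitivity ('C(n, k)%:R * cauchy2_number (n - k) lambda *
  (k`!%:R * fps_comp (fps_pow1p x) (degenerate_log lambda) k)).
  by rewrite cauchy2_numberE; ring.
rewrite fps_comp_pow1p_degenerate_log mulr_sumr; apply: eq_bigr => m _.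
ring.
Qed.

End CharacteristicZero.

Theorem theorem2p3 (R : realType) (lambda x : R[i]) (lambda_neq0 : lambda <> 0)
    (n : nat) :
  cauchy2_poly n lambda x =
  \sum_(k < n.+1) \sum_(m < k.+1)
    'C(n, k)%:R * falling x m * cauchy2_number (n - k)%N lambda
      * lambda ^+ (k - m)%N * (stirling1 k m)%:~R.
Proof. by apply: cauchy2_polyE; apply/eqP. Qed.
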